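(* Let $K\ge2$, let $u:\mathcal P_2(\mathbb R^K)\to\mathbb R$ be of class $\mathcal C^1$ (in the sense of the context), and let $m\in\mathcal P_2(\mathbb R^K)$. Then for all $a\in\mathcal P(\{0,1\}^K)$ and $i\in[K]$, $$\lim_{T\to\infty}\sqrt T\left(u\big(A^{a,m}_{i,\sqrt T}\big)-u(m)\right)=-\mathcal V_{a,i}^\top\int D_mu(m,x)\,m(dx),$$ $$\lim_{T\to\infty}\sqrt T\left(u\big(A^{a,m}_{-i,\sqrt T}\big)-u(m)\right)=\mathcal V_{a,-i}^\top\int D_mu(m,x)\,m(dx),$$ where $$\mathcal V_{a,i}=\sum_{j:\,i\in j}\frac{a(j)}{\hat a(i)}e_{j^c}\in\mathbb R^K,\qquad \mathcal V_{a,-i}=\sum_{j:\,i\notin j}\frac{a(j)}{\hat a(-i)}e_{j}\in\mathbb R^K.$$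
   Context: Notation: $[K]=\{1,\dots,K\}$; elements of $\{0,1\}^K$ are identified with subsets $j\subset[K]$, $j^c=[K]\setminus j$; $e_1,\dots,e_K$ is the canonical basis of $\mathbb R^K$ and $e_j=\sum_{i\in j}e_i$. For $a\in\mathcal P(\{0,1\}^K)$ (probability measures on $\{0,1\}^K$), $\hat a(i)=\sum_{j:i\in j}a(j)$, $\hat a(-i)=\sum_{j:i\notin j}a(j)$. $\mathcal P_2(\mathbb R^K)$ is the set of probability measures on $\mathbb R^K$ with finite second moment (Wasserstein space). For a finite measure $\mu$ on $\mathbb R^K$, $v\in\mathbb R^K$, $\lambda\in\mathbb R$: $\int f\,d\mu_{\sharp v}=\int f(x+v)\,\mu(dx)$ and $\int f\,d\mu^{*\lambda}=\int f(\lambda x)\,\mu(dx)$. Define $$A^{a,m}_{i,\sqrt T}=\Big(\sum_{j:\,i\in j}\big(\tfrac{a(j)}{\hat a(i)}m^{*\sqrt T}\big)_{\sharp -e_{j^c}}\Big)^{*\frac1{\sqrt T}},\qquad A^{a,m}_{-i,\sqrt T}=\Big(\sum_{j:\,i\notin j}\big(\tfrac{a(j)}{\hat a(-i)}m^{*\sqrt T}\big)_{\sharp e_{j}}\Big)^{*\frac1{\sqrt T}}.$$ These are rescaled Bayesian belief updates; for the belief update (the measure inside the outer parentheses) the convention is that it equals $\delta_{\mathbf 0}$ when the corresponding $\hat a(i)$ or $\hat a(-i)$ vanishes. Derivatives: $u:\mathcal P_2(\mathbb R^K)\to\mathbb R$ is Fréchet differentiable if there is a continuous $\frac{\delta u}{\delta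 m}:\mathcal P_2(\mathbb R^K)\times\mathbb R^K\to\mathbb R$ such that for all $m,m'\in\mathcal P_2(\mathbb R^K)$, $$\lim_{h\to0}\frac{u(m+h(m'-m))-u(m)}{h}=\int\frac{\delta u}{\delta m}(m,x)\,(m'-m)(dx).$$ If $\frac{\delta u}{\delta m}$ is differentiable in $x$, $D_mu(m,x)=D_x\frac{\delta u}{\delta m}(m,x)\in\mathbb R^K$. $u$ is of class $\mathcal C^1$ if $D_mu(m,x)$ is continuous and has at most quadratic growth in $x$, i.e. $|D_mu(m,x)|\le C(1+|x|^2)$.
   Formalization: The first limit is stated only when â(i)>0 and the second only when â(−i)>0; otherwise the weights in V are 0/0 and, with the δ_0 convention, the left side can diverge. *)

(* Defs.v *)
From HB Require Import structures.
From mathcomp Require Import all_boot all_order all_algebra.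
From mathcomp Require Import ring lra.
From mathcomp Require Import all_classical all_reals all_analysis.
From mathcomp Require Import measurable_realfun measurable_fun_approximation.
Import Order.TTheory GRing.Theory Num.Theory.
Import numFieldNormedType.Exports.

Set Implicit Arguments.
Unset Strict Implicit.
Unset Printing Implicit Defensive.

Local Open Scope classical_set_scope.
Local Open Scope ring_scope.

(* R^K is 'rV[R]_K. Its library norm is the sup norm, which induces the usual
   topology; the Euclidean norm is enorm. *)

Section euclidean.
Context (R : realType) (K : nat).
Implicit Types (v w : 'rV[R]_K).

Definition dotv v w : R := \sum_(k < K) v 0 k * w 0 k.

Definition enorm v : R := Num.sqrt (dotv v v).

Definition basis_sum (j : {set 'I_K}) : 'rV[R]_K :=
  \sum_(i in j) delta_mx 0 i.

Lemma dotvv_ge0 v : 0 <= dotv v v.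
Proof. by apply: sumr_ge0 => k _; rewrite -expr2 sqr_ge0. Qed.

Lemma enorm_sq v : enorm v ^+ 2 = dotv v v.
Proof. by rewrite sqr_sqrtr// dotvv_ge0. Qed.

Lemma enorm_sqZ (l : R) v : enorm (l *: v) ^+ 2 = l ^+ 2 * enorm v ^+ 2.
Proof.
rewrite !enorm_sq /dotv mulr_sumr; apply: eq_bigr => k _.
by rewrite !mxE -!expr2 exprMn.
Qed.

Lemma enorm_sqD v w :
  enorm (v + w) ^+ 2 <= 2 * enorm v ^+ 2 + 2 * enorm w ^+ 2.
Proof.
rewrite !enorm_sq /dotv !mulr_sumr -big_split/=; apply: ler_sum => k _.
rewrite !mxE -subr_ge0.
rewrite [X in 0 <= X](_ : _ = (v 0 k - w 0 k) ^+ 2) ?sqr_ge0//.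
by rewrite !mulrDl !mulrDr; ring.
Qed.

End euclidean.

Definition rV_display : measure_display. Proof. exact. Qed.

(* R^K is equipped with its Borel sigma-algebra. *)
Section borel.
Context (R : realType) (K : nat).

Let borel0 : <<s @open 'rV[R]_K >> set0.
Proof. exact: sigma_algebra0. Qed.

Let borelC A : <<s @open 'rV[R]_K >> A -> <<s @open 'rV[R]_K >> (~` A).
Proof. exact: sigma_algebraC. Qed.

Let borelU (F : (set 'rV[R]_K)^nat) :
  (forall n, <<s @open 'rV[R]_K >> (F n)) ->
  <<s @open 'rV[R]_K >> (\bigcup_n F n).
Proof. exact: sigma_algebra_bigcup. Qed.

HB.instance Definition _ := @isMeasurable.Build rV_display 'rV[R]_K
  <<s @open 'rV[R]_K >> borel0 borelC borelU.

End borel.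

Section borel_lemmas.
Context (R : realType) (K : nat).

Lemma measurable_fun_rV (f : 'rV[R]_K -> 'rV[R]_K) :
  continuous f -> measurable_fun setT f.
Proof.
move=> cf; apply: (measurability (@open 'rV[R]_K)) => //.
move=> _ [B oB <-]; rewrite setTI; apply: sub_sigma_algebra.
by move/continuousP : cf; exact.
Qed.

Lemma measurable_fun_rV_real (f : 'rV[R]_K -> R) :
  continuous f -> measurable_fun setT f.
Proof.
move=> cf; apply: (measurability _ (RGenOInfty.measurableE R)) => //.
move=> _ [_ [x ->] <-]; rewrite setTI; apply: sub_sigma_algebra.
by move/continuousP : cf; apply; rewrite set_itvE; exact: open_gt.
Qed.

Lemma measurable_enorm_sq :
  measurable_fun setT (fun x : 'rV[R]_K => (enorm x ^+ 2)%:E).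
Proof.
apply/measurable_EFinP; under eq_fun do rewrite enorm_sq /dotv.
apply: measurable_sum => k.
by apply: measurable_funM; apply: measurable_fun_rV_real;
   exact: coord_continuous.
Qed.

End borel_lemmas.

Section translation_dilation.
Context (R : realType) (K : nat).
Implicit Types (x v : 'rV[R]_K) (l : R).

Definition translation v x := x + v.

Definition dilation l x := l *: x.

Let measurable_translation v : measurable_fun setT (translation v).
Proof.
apply: measurable_fun_rV => x; rewrite /translation.
by apply: (@continuousD _ _ _ id (cst v)) => //; exact: cst_continuous.
Qed.

HB.instance Definition _ v := isMeasurableFun.Build _ _ _ _ (translation v)
  (measurable_translation v).

Let measurable_dilation l : measurable_fun setT (dilation l).
Proof. by apply: measurable_fun_rV; exact: scaler_continuous. Qed.

HB.instance Definition _ l := isMeasurableFun.Build _ _ _ _ (dilation l)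
  (measurable_dilation l).

End translation_dilation.

Section image_measure.
Context (R : realType) (K : nat).
Local Notation E := 'rV[R]_K.

Definition image_measure (mu : {measure set E -> \bar R}) (f : {mfun E >-> E})
  : set E -> \bar R := pushforward mu f.

Section instance.
Variables (mu : {measure set E -> \bar R}) (f : {mfun E >-> E}).

Let image_measure0 : image_measure mu f set0 = 0%E.
Proof. exact: measure0. Qed.

Let image_measure_ge0 A : (0 <= image_measure mu f A)%E.
Proof. exact: measure_ge0. Qed.

Let image_measure_sigma_additive : semi_sigma_additive (image_measure mu f).
Proof. exact: measure_semi_sigma_additive. Qed.

HB.instance Definition _ := isMeasure.Build _ _ _ (image_measure mu f)
  image_measure0 image_measure_ge0 image_measure_sigma_additive.

End instance.
End image_measure.

Section sum_measure.
Context (R : realType) (K : nat).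
Local Notation E := 'rV[R]_K.
Variables (P : pred {set 'I_K}) (mu : {set 'I_K} -> {measure set E -> \bar R}).

Definition sum_measure (B : set E) : \bar R := (\sum_(j | P j) mu j B)%E.

Lemma sum_measureE : sum_measure =
  msum (fun n => mu (nth finset.set0 (enum P) n)) (size (enum P)).
Proof.
apply/funext => B; rewrite /sum_measure /msum -big_enum/= (big_nth finset.set0).
by rewrite big_mkord.
Qed.

Let sum_measure0 : sum_measure set0 = 0%E.
Proof. by rewrite sum_measureE measure0. Qed.

Let sum_measure_ge0 B : (0 <= sum_measure B)%E.
Proof. by rewrite sum_measureE measure_ge0. Qed.

Let sum_measure_sigma_additive : semi_sigma_additive sum_measure.
Proof. by rewrite sum_measureE; exact: measure_semi_sigma_additive. Qed.

HB.instance Definition _ := isMeasure.Build _ _ _ sum_measure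
  sum_measure0 sum_measure_ge0 sum_measure_sigma_additive.

Lemma ge0_integral_sum_measure (f : E -> \bar R) :
  measurable_fun setT f -> (forall x, (0 <= f x)%E) ->
  (\int[sum_measure]_x f x = \sum_(j | P j) \int[mu j]_x f x)%E.
Proof.
move=> mf f0.
rewrite (eq_measure_integral
  (msum (fun n => mu (nth finset.set0 (enum P) n)) (size (enum P)))); last first.
  by move=> B _ _; rewrite /= sum_measureE.
rewrite ge0_integral_measure_sum//.
by rewrite -[RHS]big_enum/= (big_nth finset.set0) big_mkord.
Qed.

End sum_measure.

Section second_moment.
Context (R : realType) (K : nat).
Local Notation E := 'rV[R]_K.
Implicit Types (mu : {measure set E -> \bar R}) (v : E) (l : R).
Local Open Scope ereal_scope.

Definition second_moment mu : \bar R := \int[mu]_x (enorm x ^+ 2)%:E.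

Lemma second_moment_translation mu v : mu setT < +oo -> second_moment mu < +oo ->
  second_moment (image_measure mu (translation v)) < +oo.
Proof.
move=> mu1 mu2; have mf := @measurable_enorm_sq R K.
have ? : forall x : E, setT x -> 0 <= (enorm x ^+ 2)%:E.
  by move=> x _; rewrite lee_fin sqr_ge0.
rewrite /second_moment ge0_integral_pushforward//=; last first.
  by move=> x _; rewrite lee_fin sqr_ge0.
rewrite preimage_setT.
apply: (@le_lt_trans _ _
    (\int[mu]_x (2%:E * (enorm x ^+ 2)%:E + (2 * enorm v ^+ 2)%:E))).
  apply: ge0_le_integral => //.
  - by move=> x _; rewrite lee_fin sqr_ge0.
  - exact: (measurableT_comp mf).
  - by apply: emeasurable_funD => //; apply: measurable_funeM.
  - by move=> x _; rewrite -EFinM -EFinD lee_fin enorm_sqD.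
rewrite ge0_integralD//; last 3 first.
  - by move=> x _; rewrite -EFinM lee_fin mulr_ge0// sqr_ge0.
  - by apply: measurable_funeM.
  - by move=> x _; rewrite lee_fin mulr_ge0// sqr_ge0.
rewrite ge0_integralZl//.
rewrite integral_cst// lte_add_pinfty// lte_mul_pinfty//.
  by rewrite lee_fin mulr_ge0// sqr_ge0.
Qed.

Lemma second_moment_dilation mu l : second_moment mu < +oo ->
  second_moment (image_measure mu (dilation l)) < +oo.
Proof.
move=> mu2; have mf := @measurable_enorm_sq R K.
rewrite /second_moment ge0_integral_pushforward//=; last first.
  by move=> x _; rewrite lee_fin sqr_ge0.
rewrite preimage_setT.
under eq_integral do rewrite /= enorm_sqZ EFinM.
rewrite ge0_integralZl//.
- by rewrite lte_mul_pinfty// lee_fin sqr_ge0.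
- by move=> x _; rewrite lee_fin sqr_ge0.
- by rewrite lee_fin sqr_ge0.
Qed.

Lemma second_moment_mscale mu (r : {nonneg R}) : second_moment mu < +oo ->
  second_moment (mscale r mu) < +oo.
Proof.
move=> mu2; have mf := @measurable_enorm_sq R K.
rewrite /second_moment ge0_integral_mscale//.
- by rewrite lte_mul_pinfty// lee_fin.
- by move=> x _; rewrite lee_fin sqr_ge0.
Qed.

Lemma second_moment_add mu nu : second_moment mu < +oo ->
  second_moment nu < +oo -> second_moment (measure_add mu nu) < +oo.
Proof.
move=> mu2 nu2; have mf := @measurable_enorm_sq R K.
rewrite /second_moment ge0_integral_measure_add//.
- by rewrite lte_add_pinfty.
- by move=> x _; rewrite lee_fin sqr_ge0.
Qed.

Lemma second_moment_sum (P : pred {set 'I_K})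
    (mu : {set 'I_K} -> {measure set E -> \bar R}) :
  (forall j, P j -> second_moment (mu j) < +oo) ->
  second_moment (sum_measure P mu) < +oo.
Proof.
move=> mu2; have mf := @measurable_enorm_sq R K.
rewrite /second_moment ge0_integral_sum_measure//.
- exact: lte_sum_pinfty.
- by move=> x; rewrite lee_fin sqr_ge0.
Qed.

Lemma second_moment_dirac0 : second_moment (@dirac _ E 0%R R) < +oo.
Proof.
rewrite /second_moment integral_dirac//; last exact: measurable_enorm_sq.
by rewrite diracT mul1e ltry.
Qed.

End second_moment.

Record P2 (R : realType) (K : nat) := MkP2 {
  P2_prob :> probability 'rV[R]_K R ;
  P2_second_moment : (second_moment P2_prob < +oo)%E }.

Section P2_of_measure.
Context (R : realType) (K : nat) (mu : {measure set 'rV[R]_K -> \bar R}).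
Hypotheses (mu1 : mu setT = 1%E) (mu2 : (second_moment mu < +oo)%E).

Definition prob_of_measure (_ : mu setT = 1%E) : set 'rV[R]_K -> \bar R := mu.

HB.instance Definition _ := Measure.on (prob_of_measure mu1).
HB.instance Definition _ :=
  Measure_isProbability.Build _ _ _ (prob_of_measure mu1) mu1.

Definition P2_of_measure : P2 R K := @MkP2 R K (prob_of_measure mu1) mu2.

End P2_of_measure.

Section P2_operations.
Context (R : realType) (K : nat).
Implicit Types (m : P2 R K).

Let dilate_mass m (l : R) : image_measure m (dilation l) setT = 1%E.
Proof. by rewrite /image_measure/= /pushforward preimage_setT probability_setT. Qed.

Definition P2_dilate m (l : R) : P2 R K :=
  P2_of_measure (dilate_mass m l) (second_moment_dilation l (P2_second_moment m)).

Definition clamp01 (h : R) : R := Num.max 0 (Num.min h 1).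

Let clamp01_ge0 h : 0 <= clamp01 h.
Proof. by rewrite /clamp01 le_max lexx. Qed.

Let clamp01_le1 h : 0 <= 1 - clamp01 h.
Proof. by rewrite subr_ge0 /clamp01 ge_max ler01 ge_min lexx orbT. Qed.

Definition mix_measure (h : R) m m' : {measure set 'rV[R]_K -> \bar R} :=
  measure_add (mscale (NngNum (clamp01_le1 h)) m)
              (mscale (NngNum (clamp01_ge0 h)) m').

Let mix_mass h m m' : mix_measure h m m' setT = 1%E.
Proof.
rewrite [LHS]measure_addE/= /mscale/= !probability_setT !mule1.
by rewrite -EFinD subrK.
Qed.

Let mix_moment h m m' : (second_moment (mix_measure h m m') < +oo)%E.
Proof.
by apply: second_moment_add; apply: second_moment_mscale;
   exact: P2_second_moment.
Qed.

(* m + h (m' - m) is a probability measure for h in [0, 1]; the clamping only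
   makes the definition total. *)
Definition P2_mix (h : R) m m' : P2 R K :=
  P2_of_measure (mix_mass h m m') (mix_moment h m m').

End P2_operations.

(* The product coupling of two elements of P2 has finite cost, so that the
   infimum below is finite. The topology of P2 is the one of W2. *)
Section wasserstein.
Context (R : realType) (K : nat).
Local Notation E := 'rV[R]_K.
Implicit Types (m : P2 R K).

Definition coupling m m' : set (probability (E * E)%type R) :=
  [set pi | forall B : set E, measurable B ->
     pi (fst @^-1` B) = m B /\ pi (snd @^-1` B) = m' B].

Definition transport_cost (pi : probability (E * E)%type R) : \bar R :=
  (\int[pi]_z (enorm (z.1 - z.2) ^+ 2)%:E)%E.

Definition W2 m m' : R :=
  Num.sqrt (fine (ereal_inf (transport_cost @` coupling m m'))).

Definition W2_nbhs m : set_system (P2 R K) :=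
  filter_from [set e : R | 0 < e] (fun e => [set m' | W2 m m' < e]).

HB.instance Definition _ := gen_eqMixin (P2 R K).
HB.instance Definition _ := gen_choiceMixin (P2 R K).
HB.instance Definition _ := hasNbhs.Build (P2 R K) W2_nbhs.

End wasserstein.

Section derivatives.
Context (R : realType) (K : nat).
Implicit Types (u : P2 R K -> R) (m : P2 R K).

(* The existence of the integrals is implicit in the defining identity; as an
   integral of a non-integrable function has a default value, it is stated
   explicitly. The quotient only makes sense for h in [0, 1], hence the limit
   from the right. *)
Definition is_flat_derivative u (f : P2 R K -> 'rV[R]_K -> R) : Prop :=
  [/\ continuous (fun z : P2 R K * 'rV[R]_K => f z.1 z.2),
      forall m m', m'.-integrable setT (EFin \o f m)
    & forall m m',
        (u (P2_mix h m m') - u m) / h @[h --> 0^'+] -->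
        \int[m']_x f m x - \int[m]_x f m x].

Definition frechet_differentiable u : Prop :=
  exists f, is_flat_derivative u f.

(* A flat derivative is unique up to a function of m alone, so that D_m u does
   not depend on the one selected here. *)
Definition flat_derivative u : P2 R K -> 'rV[R]_K -> R :=
  xget (fun _ _ => 0) [set f | is_flat_derivative u f].

Definition Dm u m (x : 'rV[R]_K) : 'rV[R]_K :=
  \row_k 'D_(delta_mx 0 k) (flat_derivative u m) x.

Definition C1 u : Prop :=
  [/\ frechet_differentiable u,
      forall m x, differentiable (flat_derivative u m) x,
      continuous (fun z : P2 R K * 'rV[R]_K => Dm u z.1 z.2)
    & exists C : R, forall m x, enorm (Dm u m x) <= C * (1 + enorm x ^+ 2)].

Definition vintegral m (f : 'rV[R]_K -> 'rV[R]_K) : 'rV[R]_K :=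
  \row_k \int[m]_x f x 0 k.

End derivatives.

(* Probability measures on {0,1}^K, whose elements are encoded as subsets of
   {0, ..., K-1}. *)
Record distr (R : realType) (K : nat) := MkDistr {
  weight :> {set 'I_K} -> R ;
  weight_ge0 : forall j, 0 <= weight j ;
  weight_sum1 : \sum_j weight j = 1 }.

Section belief_update.
Context (R : realType) (K : nat).
Local Notation E := 'rV[R]_K.
Implicit Types (a : distr R K) (P : pred {set 'I_K}) (v : {set 'I_K} -> E).
Implicit Types (m : P2 R K) (i : 'I_K) (s : R).

Definition mass a P : R := \sum_(j | P j) a j.

Let cond_ge0 a P j : 0 <= a j / mass a P.
Proof. by rewrite divr_ge0 ?weight_ge0// sumr_ge0// => k _; rewrite weight_ge0. Qed.

Definition cond a P (j : {set 'I_K}) : {nonneg R} := NngNum (cond_ge0 a P j).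

(* The common form of the two belief updates: P is the set of outcomes
   compatible with the observation and v j is the translation after outcome j.
   If P has mass 0, the update is conventionally the Dirac mass at 0. *)
Definition update_measure a P v m : {measure set E -> \bar R} :=
  if mass a P == 0 then (\d_(0 : E) : {measure set E -> \bar R})
  else (sum_measure P
    (fun j => image_measure (mscale (cond a P j) m) (translation (v j)))
    : {measure set E -> \bar R}).

Let update_mass a P v m : update_measure a P v m setT = 1%E.
Proof.
rewrite /update_measure; case: ifPn => [_|aP]; first exact: diracT.
rewrite /= /sum_measure.
under eq_bigr do
  rewrite /image_measure/= /pushforward preimage_setT /mscale/=
    probability_setT mule1.
by rewrite sumEFin -mulr_suml divff.
Qed.

Let update_moment a P v m : (second_moment (update_measure a P v m) < +oo)%E.
Proof.
rewrite /update_measure; case: ifPn => [_|aP]; first exact: second_moment_dirac0.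
apply: second_moment_sum => j _; apply: second_moment_translation.
  by rewrite /= /mscale/= probability_setT mule1 ltry.
exact/second_moment_mscale/P2_second_moment.
Qed.

Definition update a P v m : P2 R K :=
  P2_of_measure (update_mass a P v m) (update_moment a P v m).

(* s plays the role of sqrt T. *)
Definition A_pos a m i s : P2 R K :=
  P2_dilate (update a (fun j => i \in j) (fun j => - basis_sum R (~: j))
                    (P2_dilate m s)) (1 / s).

Definition A_neg a m i s : P2 R K :=
  P2_dilate (update a (fun j => i \notin j) (fun j => basis_sum R j)
                    (P2_dilate m s)) (1 / s).

Definition hat_pos a i : R := mass a (fun j => i \in j).

Definition hat_neg a i : R := mass a (fun j => i \notin j).

(* Meaningful only if hat_pos a i (resp. hat_neg a i) is nonzero. *)
Definition V_pos a i : E :=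
  \sum_(j : {set 'I_K} | i \in j) (a j / hat_pos a i) *: basis_sum R (~: j).

Definition V_neg a i : E :=
  \sum_(j : {set 'I_K} | i \notin j) (a j / hat_neg a i) *: basis_sum R j.

End belief_update.

(* Main.v *)
(** Write A_s for the rescaled update, s = sqrt T.  It is the mixture
    sum_j w_j (tau_{v_j/s})_# m of small translates of m, where tau_v is the
    translation by v.  Along the segment from m to A_s the function u is
    differentiable, so the mean value theorem gives
    u(A_s) - u(m) = sum_j w_j int [f(mu_s, x + v_j/s) - f(mu_s, x)] m(dx),
    where f = du/dm and mu_s is a point of that segment.  An explicit coupling
    shows W2(m, mu_s) = O(1/s), so that, by the mean value theorem in x and the
    joint continuity of D_m u, the integrand multiplied by s tends to
    v_j . D_m u(m, x); the quadratic growth of D_m u gives the domination. *)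

Require Import Defs.
From HB Require Import structures.
From mathcomp Require Import all_boot all_order all_algebra.
From mathcomp Require Import ring lra.
From mathcomp Require Import all_classical all_reals all_analysis.
From mathcomp Require Import measurable_realfun.
Import Order.TTheory GRing.Theory Num.Theory.
Import numFieldNormedType.Exports.

Set Implicit Arguments.
Unset Strict Implicit.
Unset Printing Implicit Defensive.

Local Open Scope classical_set_scope.
Local Open Scope ring_scope.

(** * Finite mixtures of measures and their integrals *)

Section finite_mixture.
Context d (T : measurableType d) (R : realType) (I : finType).
Variables (w : I -> R) (w0 : forall i, 0 <= w i).
Variables (nu : I -> {measure set T -> \bar R}).

(** [msum] sums a sequence indexed by naturals, so [I] is enumerated; the default [mzero] only
    occurs from [#|I|] on, outside the range of the sum. *)
Let summand (n : nat) : {measure set T -> \bar R} :=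
  match insub n : option 'I_#|I| with
  | Some k => mscale (NngNum (w0 (@enum_val I I k))) (nu (@enum_val I I k))
  | None => mzero
  end.

Definition finite_mixture : {measure set T -> \bar R} := msum summand #|I|.


Lemma finite_mixtureE B : (finite_mixture B = \sum_i (w i)%:E * nu i B)%E.
Proof.
rewrite /finite_mixture /msum [RHS](reindex _ (onW_bij _ (@enum_val_bij I))).
by apply: eq_bigr => k _; rewrite /summand valK.
Qed.

Lemma ge0_integral_finite_mixture (f : T -> \bar R) :
  measurable_fun setT f -> (forall x, 0 <= f x)%E ->
  (\int[finite_mixture]_x f x = \sum_i (w i)%:E * \int[nu i]_x f x)%E.
Proof.
move=> mf f0; rewrite ge0_integral_measure_sum//.
rewrite [RHS](reindex _ (onW_bij _ (@enum_val_bij I))); apply: eq_bigr => k _.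
by rewrite /summand valK ge0_integral_mscale.
Qed.

(** The nonnegative case applies to the positive and negative parts, and integrability makes all the
    values finite, so that they can be subtracted termwise. The measure [mu] is given by its values
    only, which covers both [P2_mix] and the rescaled updates. *)
Lemma Rintegral_finite_mixture (mu : {measure set T -> \bar R}) (f : T -> R) :
  (forall B, measurable B -> mu B = (\sum_i (w i)%:E * nu i B)%E) ->
  mu.-integrable setT (EFin \o f) ->
  (forall i, (nu i).-integrable setT (EFin \o f)) ->
  \int[mu]_x f x = \sum_i w i * \int[nu i]_x f x.
Proof.
move=> muE fmu fnu; have mf := measurable_int _ fmu.
have E (g : T -> \bar R) : measurable_fun setT g -> (forall x, 0 <= g x)%E ->
    (\int[mu]_x g x = \sum_i (w i)%:E * \int[nu i]_x g x)%E.
  move=> mg g0; rewrite -ge0_integral_finite_mixture//.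
  by apply: eq_measure_integral => B mB _; rewrite muE// -finite_mixtureE.
rewrite /Rintegral integralE !E//; last 2 first.
- exact: measurable_funeneg.
- exact: measurable_funepos.
have fp i : (\int[nu i]_x (EFin \o f)^\+ x)%E \is a fin_num.
  exact/integrable_fin_num/integrable_funepos.
have fn i : (\int[nu i]_x (EFin \o f)^\- x)%E \is a fin_num.
  exact/integrable_fin_num/integrable_funeneg.
under eq_bigr do rewrite -(fineK (fp _)) -EFinM.
under [X in (_ - X)%E]eq_bigr do rewrite -(fineK (fn _)) -EFinM.
rewrite !sumEFin -EFinB/= -sumrB; apply: eq_bigr => i _.
by rewrite -mulrBr -fineB ?fp ?fn// [in RHS]integralE.
Qed.

End finite_mixture.

(** * Segments in the Wasserstein space *)

Lemma P2_ext (R : realType) (K : nat) (m m' : P2 R K) :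
  (forall B, m B = m' B) -> m = m'.
Proof.
case: m m' => [[f cf] m2] [[g cg] m'2] /= fg.
have {}fg : f = g by apply/funext.
subst g.
(* Once the set functions are identified, all remaining fields of the structure are proofs. *)
have E : cf = cg.
  case: cf {m2} => [[a1 a1'] [a2] [a3] [a4] [a5] [a6] [a7]].
  case: cg {m'2} => [[b1 b1'] [b2] [b3] [b4] [b5] [b6] [b7]].
  rewrite (Prop_irrelevance b1 a1) (Prop_irrelevance b1' a1').
  rewrite (Prop_irrelevance b3 a3) (Prop_irrelevance b4 a4).
  rewrite (Prop_irrelevance b5 a5) (Prop_irrelevance b6 a6).
  by rewrite (Prop_irrelevance b7 a7) (Prop_irrelevance b2 a2).
move: m2 m'2; rewrite E => m2 m'2; congr MkP2; exact: Prop_irrelevance.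
Qed.

Section mixtures.
Context (R : realType) (K : nat).
Implicit Types (m : P2 R K) (h : R).

Lemma P2_mixE h m m' B : 0 <= h <= 1 ->
  (P2_mix h m m' B = (1 - h)%:E * m B + h%:E * m' B)%E.
Proof.
move=> /andP[h0 h1].
have ch : clamp01 h = h by rewrite /clamp01 (min_idPl h1) (max_idPr h0).
by rewrite [LHS]measure_addE/= /mscale/= ch.
Qed.

Lemma P2_mix0 m m' : P2_mix 0 m m' = m.
Proof.
by apply: P2_ext => B; rewrite P2_mixE ?lexx ?ler01// subr0 mul1e mul0e adde0.
Qed.

Lemma P2_mix1 m m' : P2_mix 1 m m' = m'.
Proof.
by apply: P2_ext => B; rewrite P2_mixE ?lexx ?ler01// subrr mul1e mul0e add0e.
Qed.

Lemma P2_mixC h m m' : 0 <= h <= 1 -> P2_mix h m m' = P2_mix (1 - h) m' m.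
Proof.
move=> h01; have h01' : 0 <= 1 - h <= 1 by lra.
by apply: P2_ext => B; rewrite !P2_mixE// addeC subKr.
Qed.

Lemma P2_mix_mix h e m m' : 0 <= h <= 1 -> 0 <= e <= 1 ->
  P2_mix e (P2_mix h m m') m' = P2_mix (h + e * (1 - h)) m m'.
Proof.
move=> h01 e01; have he01 : 0 <= h + e * (1 - h) <= 1 by nra.
have p1 : 0 <= 1 - h by lra.
have p2 : 0 <= 1 - e by lra.
have p3 : 0 <= h by lra.
apply: P2_ext => B; rewrite !P2_mixE//.
rewrite ge0_muleDr; [|by apply: mule_ge0; rewrite ?lee_fin..].
rewrite !muleA -!EFinM -addeA -ge0_muleDl ?lee_fin ?mulr_ge0//; last by lra.
by rewrite -EFinD; congr (_%:E * _ + _%:E * _)%E; ring.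
Qed.

End mixtures.

Lemma Rintegral_P2_mix (R : realType) (K : nat) (m m' : P2 R K) (h : R)
    (f : 'rV[R]_K -> R) : 0 <= h <= 1 ->
  (forall n : P2 R K, n.-integrable setT (EFin \o f)) ->
  \int[P2_mix h m m']_x f x = (1 - h) * \int[m]_x f x + h * \int[m']_x f x.
Proof.
move=> h01 intf.
have h1 (b : bool) : 0 <= if b then h else 1 - h by case: b; lra.
rewrite (@Rintegral_finite_mixture _ _ _ bool _ h1
  (fun b => if b then m' else m)).
- by rewrite big_bool/= addrC.
- by move=> B _; apply: (etrans (P2_mixE m m' B h01)); rewrite big_bool/= addeC.
- exact: intf.
- by case; exact: intf.
Qed.

(** * Differentiability and the mean value theorem along a segment *)

Lemma cvg_of_quotient (R : realType) (F G : R -> R) (b L : R) :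
  (forall d, 0 < d -> F d != 0) -> F d @[d --> 0^'+] --> 0 ->
  (G d - b) / F d @[d --> 0^'+] --> L -> G d @[d --> 0^'+] --> b.
Proof.
move=> F_neq0 F0 GL.
have : (G d - b) / F d * F d + b @[d --> 0^'+] --> L * 0 + b.
  by apply: cvgD; [exact: cvgM|exact: cvg_cst].
rewrite mulr0 add0r; apply: cvg_trans; apply: near_eq_cvg; near=> d.
by rewrite divfK ?subrK// F_neq0//; near: d; exact: nbhs_right_gt.
Unshelve. all: end_near.
Qed.

Section mean_value.
Context (R : realType) (K : nat).
Variables (u : P2 R K -> R) (f : P2 R K -> 'rV[R]_K -> R).
Implicit Types (m : P2 R K) (h : R).
Hypothesis uf : is_flat_derivative u f.

(* The point of parameter h + d on the segment from m to m' has parameter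
   d / (1 - h) on the segment from the point of parameter h to m'. *)
Lemma right_derivative_P2_mix m m' h : 0 <= h < 1 ->
  (u (P2_mix (h + d) m m') - u (P2_mix h m m')) / d @[d --> 0^'+] -->
  \int[m']_x f (P2_mix h m m') x - \int[m]_x f (P2_mix h m m') x.
Proof.
move=> h01; have h1 : 0 < 1 - h by lra.
have hle : 0 <= h <= 1 by lra.
case: uf => _ intf /(_ (P2_mix h m m') m') D.
have E : d / (1 - h) @[d --> 0^'+] --> 0^'+.
  move=> P [e /= e0 eP]; exists (e * (1 - h)) => /=; first exact: mulr_gt0.
  move=> d /=; rewrite sub0r normrN => de d0; apply: eP => /=.
    by rewrite sub0r normrN normrM normfV (gtr0_norm h1) ltr_pdivrMr.
  exact: divr_gt0.
have {D E} := cvg_comp _ _ E D => D.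
(* By linearity of the integral in the measure, replacing [m] by the point of parameter [h] shrinks
   the difference by the factor [1 - h]; this cancels the change of parameter. *)
have -> : \int[m']_x f (P2_mix h m m') x - \int[m]_x f (P2_mix h m m') x =
  (\int[m']_x f (P2_mix h m m') x -
   \int[P2_mix h m m']_x f (P2_mix h m m') x) / (1 - h).
  by rewrite Rintegral_P2_mix//; field; rewrite gt_eqF.
have {}D : (u (P2_mix (d / (1 - h)) (P2_mix h m m') m') - u (P2_mix h m m')) /
    (d / (1 - h)) / (1 - h) @[d --> 0^'+] -->
  (\int[m']_x f (P2_mix h m m') x -
   \int[P2_mix h m m']_x f (P2_mix h m m') x) / (1 - h).
  by apply: cvgMr_tmp; exact: D.
move: D; apply: cvg_trans; apply: near_eq_cvg; near=> d => /=.
have d0 : 0 < d by near: d; exact: nbhs_right_gt.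
have d1 : d < 1 - h by near: d; exact: nbhs_right_lt.
rewrite P2_mix_mix//; last first.
  apply/andP; split; first by apply: divr_ge0; exact: ltW.
  by rewrite ler_pdivrMr// mul1r ltW.
rewrite divfK ?gt_eqF//; field.
by rewrite !gt_eqF.
Unshelve. all: end_near.
Qed.

(** Reversing the segment turns the left derivative at [h] into a right derivative at [1 - h], with
    the opposite sign. *)
Lemma left_derivative_P2_mix m m' h : 0 < h <= 1 ->
  (u (P2_mix (h - d) m m') - u (P2_mix h m m')) / - d @[d --> 0^'+] -->
  \int[m']_x f (P2_mix h m m') x - \int[m]_x f (P2_mix h m m') x.
Proof.
move=> h01; have hle : 0 <= h <= 1 by lra.
have h01' : 0 <= 1 - h < 1 by lra.
have /cvgN := @right_derivative_P2_mix m' m _ h01'.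
rewrite -P2_mixC// opprB; apply: cvg_trans; apply: near_eq_cvg; near=> d => /=.
have d0 : 0 < d by near: d; exact: nbhs_right_gt.
have d1 : d < h by near: d; apply: nbhs_right_lt; lra.
rewrite (P2_mixC m m' (h := h - d)); last by lra.
by rewrite opprB addrA addrAC invrN mulrN.
Unshelve. all: end_near.
Qed.

Lemma is_derive_P2_mix m m' h : 0 < h < 1 ->
  is_derive h (1 : R) (fun h : R => u (P2_mix h m m'))
   (\int[m']_x f (P2_mix h m m') x - \int[m]_x f (P2_mix h m m') x).
Proof.
move=> h01.
have D : d^-1 *: (u (P2_mix (d *: 1 + h) m m') - u (P2_mix h m m'))
      @[d --> 0^'] -->
    \int[m']_x f (P2_mix h m m') x - \int[m]_x f (P2_mix h m m') x.
  apply: (@cvg_at_right_left_dnbhs _ R^o).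
    have /(@right_derivative_P2_mix m m' _) : 0 <= h < 1 by lra.
    apply: cvg_trans; apply: near_eq_cvg; apply: nearW => d /=.
    by rewrite /GRing.scale/= mulr1 [RHS]mulrC (addrC d).
  apply/cvg_at_leftNP; rewrite oppr0.
  have /(@left_derivative_P2_mix m m' _) : 0 < h <= 1 by lra.
  apply: cvg_trans; apply: near_eq_cvg; apply: nearW => d /=.
  by rewrite /GRing.scale/= mulr1 [RHS]mulrC (addrC (- d)).
split; first by apply/cvg_ex; eexists; exact: D.
exact: cvg_lim D.
Qed.

Lemma P2_mean_value m m' : exists h : R, 0 < h < 1 /\
  u m' - u m = \int[m']_x f (P2_mix h m m') x - \int[m]_x f (P2_mix h m m') x.
Proof.
pose df h := \int[m']_x f (P2_mix h m m') x - \int[m]_x f (P2_mix h m m') x.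
have [] := @MVT R (fun h : R => u (P2_mix h m m')) df 0 1 ltr01.
- by move=> h; rewrite in_itv/=; exact: is_derive_P2_mix.
- apply: derivable_oo_LRcontinuous_within; split.
  + move=> h; rewrite in_itv/= => h01.
    by have [] := @is_derive_P2_mix m m' _ h01.
  (* At the two endpoints only one-sided continuity is required; it follows from the convergence of
     the one-sided difference quotient, via [cvg_of_quotient]. *)
  + have h01 : 0 <= (0 : R) < 1 by apply/andP; split.
    have D := @right_derivative_P2_mix m m' _ h01.
    move=> A /= PA; apply/nbhs_right0P.
    apply: (cvg_of_quotient (F := id) _ _ D) PA => [d /lt0r_neq0//|].
    exact: cvg_at_right_filter.
  + have h01 : 0 < (1 : R) <= 1 by apply/andP; split.
    have D := @left_derivative_P2_mix m m' _ h01.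
    move=> A /= PA; apply/nbhs_left0P.
    apply: (cvg_of_quotient (F := -%R) _ _ D) PA => [d /lt0r_neq0|].
      by rewrite oppr_eq0.
    rewrite -[X in _ --> X]oppr0; apply: cvg_at_right_filter.
    exact: oppr_continuous.
move=> h; rewrite in_itv/= => h01; rewrite P2_mix0 P2_mix1 subr0 mulr1.
by exists h.
Qed.

End mean_value.

(** * An upper bound on [W2] from an explicit coupling *)

Section probability_of_measure.
Context d (T : measurableType d) (R : realType).
Variables (mu : {measure set T -> \bar R}) (mu1 : mu setT = 1%E).

(** The proof of total mass 1 is an argument so that the probability structure can be attached to
    the term. The space is arbitrary because couplings live on a product. *)
Definition probability_of_measure (_ : mu setT = 1%E) : set T -> \bar R := mu.

HB.instance Definition _ := Measure.on (probability_of_measure mu1).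
HB.instance Definition _ :=
  Measure_isProbability.Build _ _ _ (probability_of_measure mu1) mu1.

End probability_of_measure.

Section wasserstein_bound.
Context (R : realType) (K : nat).
Local Notation E := 'rV[R]_K.

Definition translation_graph (v x : E) : E * E := (x, translation v x).

Lemma measurable_translation_graph v :
  measurable_fun setT (translation_graph v).
Proof. by apply/measurable_fun_pair => //; exact: measurable_funP. Qed.

Lemma measurable_cost :
  measurable_fun setT (fun z : E * E => (enorm (z.1 - z.2) ^+ 2)%:E).
Proof.
apply/measurable_EFinP; under eq_fun do rewrite enorm_sq /dotv.
have mc k : measurable_fun setT (fun x : E => x 0 k).
  by apply: measurable_fun_rV_real; exact: coord_continuous.
apply: measurable_sum => k.
have md : measurable_fun setT (fun z : E * E => (z.1 - z.2) 0 k).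
  under eq_fun do rewrite !mxE.
  by apply: measurable_funB; apply: (measurableT_comp (mc k)).
exact: measurable_funM.
Qed.

(** Moving a fraction [w i] of the mass at each point by [v i] is a coupling: the mixture of the
    images of [m] under the maps [translation_graph (v i)]. The displacement does not depend on the
    point, so its cost is exactly the sum under the root. *)
Lemma W2_translations_le (I : finType) (w : I -> R) (v : I -> E)
    (m m' : P2 R K) :
  (forall i, 0 <= w i) -> \sum_i w i = 1 ->
  (forall B, measurable B ->
    m' B = (\sum_i (w i)%:E * m (translation (v i) @^-1` B))%E) ->
  W2 m m' <= Num.sqrt (\sum_i w i * enorm (v i) ^+ 2).
Proof.
move=> w0 w1 m'E.
pose nu i : {measure set (E * E) -> \bar R} :=
  measure_function_pushforward__canonical__measure_function_Measure m
    (measurable_translation_graph (v i)).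
pose pi := finite_mixture w0 nu.
have pi1 : pi setT = 1%E.
  rewrite finite_mixtureE.
  under eq_bigr do
    rewrite /nu/= /pushforward preimage_setT probability_setT mule1.
  by rewrite sumEFin w1.
have cpi : coupling m m' (probability_of_measure pi1).
  move=> B mB; rewrite /probability_of_measure !finite_mixtureE m'E//.
  split => //.
  by rewrite -[RHS]mul1e -w1 -sumEFin ge0_sume_distrl// => i _; rewrite lee_fin.
have cost : transport_cost (probability_of_measure pi1) =
    (\sum_i w i * enorm (v i) ^+ 2)%:E.
  have c0 (z : E * E) : (0 <= (enorm (z.1 - z.2) ^+ 2)%:E)%E.
    by rewrite lee_fin sqr_ge0.
  rewrite /transport_cost (eq_measure_integral pi)//.
  rewrite ge0_integral_finite_mixture//; last exact: measurable_cost.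
  rewrite -sumEFin; apply: eq_bigr => i _.
  rewrite ge0_integral_pushforward//; last 2 first.
  - exact: measurable_translation_graph.
  - exact: measurable_cost.
  rewrite preimage_setT EFinM; congr *%E.
  under eq_integral do rewrite /= /translation opprD addNKr.
  rewrite integral_cst// [X in (_ * X)%E](probability_setT m) mule1.
  by rewrite !enorm_sq /dotv; under eq_bigr do rewrite !mxE mulrNN.
rewrite ler_wsqrtr//.
have le : (ereal_inf (@transport_cost R K @` coupling m m') <=
    (\sum_i w i * enorm (v i) ^+ 2)%:E)%E.
  by apply: ereal_inf_lbound; exists (probability_of_measure pi1).
(* [fine] is monotone on finite values only; the infimum is finite because it lies between 0 and the
   cost just computed. *)
rewrite -[leRHS]/(fine (\sum_i w i * enorm (v i) ^+ 2)%:E) fine_le//.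
rewrite ge0_fin_numE; first exact: le_lt_trans le (ltry _).
apply: le_ereal_inf_tmp => _ [q _ <-].
by apply: integral_ge0 => z _; rewrite lee_fin sqr_ge0.
Qed.

End wasserstein_bound.

(** * Convergence in [W2], and the mean value theorem on a line of R^K *)

Section first_variation.
Context (R : realType) (K : nat).
Local Notation E := 'rV[R]_K.
Implicit Types (m : P2 R K) (x v w : E).

Lemma W2_ge0 m m' : 0 <= W2 m m'.
Proof. exact: sqrtr_ge0. Qed.

(** [P2] is declared with neighbourhoods only; their filter property is needed for convergence in
    the product of [P2] and R^K. *)
#[global] Instance W2_nbhs_filter m : Filter (W2_nbhs m).
Proof.
apply: filter_from_filter; first by exists 1 => /=.
move=> e e' e0 e'0; exists (Num.min e e') => /=; first by rewrite lt_min e0.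
by move=> m' /=; rewrite lt_min => /andP.
Qed.

Lemma cvg_W2 (I : Type) (F : set_system I) {FF : Filter F}
    (mm : I -> P2 R K) m :
  W2 m (mm i) @[i --> F] --> 0 -> mm i @[i --> F] --> m.
Proof.
move=> mm0 P [e /= e0 eP].
have /cvgrPdist_lt /(_ _ e0) := mm0; apply: filterS => i.
by rewrite sub0r normrN ger0_norm ?W2_ge0// => ?; exact: eP.
Qed.

Lemma W2_refl m : W2 m m = 0.
Proof.
apply/eqP; rewrite eq_le W2_ge0 andbT.
apply: le_trans (@W2_translations_le _ _ unit (fun=> 1) (fun=> 0) m m _ _ _) _.
- by [].
- by rewrite big_const card_unit/= addr0.
- move=> B _; rewrite big_const card_unit/= adde0 mul1e; congr (m _).
  by apply/seteqP; split => x; rewrite /= /translation addr0.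
- rewrite big_const card_unit/= addr0 mul1r enorm_sq /dotv.
  by rewrite big1 ?sqrtr0// => k _; rewrite mxE mul0r.
Qed.

Lemma normr_coord_le_enorm v k : `|v 0 k| <= enorm v.
Proof.
rewrite -(@ler_pXn2r _ 2)// ?nnegrE ?sqrtr_ge0// enorm_sq /dotv.
rewrite real_normK ?num_real//.
by rewrite (bigD1 k)//= -expr2 lerDl sumr_ge0// => i _; rewrite -expr2 sqr_ge0.
Qed.

(** A crude form of the Cauchy-Schwarz inequality: domination only asks for a constant depending on
    [v] alone. *)
Lemma normr_dotv_le v w : `|dotv v w| <= (\sum_k `|v 0 k|) * enorm w.
Proof.
rewrite /dotv (le_trans (ler_norm_sum _ _ _))// mulr_suml ler_sum// => k _.
by rewrite normrM ler_wpM2l// normr_coord_le_enorm.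
Qed.

(** Expanding [v] in the canonical basis expresses the differential through partial derivatives, the
    form in which [Dm] is defined. *)
Lemma diff_dotv (g : E -> R) x v : differentiable g x ->
  'd g x v = dotv v (\row_k 'D_(delta_mx 0 k) g x).
Proof.
move=> dg; rewrite {1}(row_sum_delta v) linear_sum /dotv; apply: eq_bigr => k _.
by rewrite linearZ mxE deriveE.
Qed.

Lemma mean_value_line (g : E -> R) x v : (forall y, differentiable g y) ->
  exists2 t, 0 < t < 1 &
    g (x + v) - g x = dotv v (\row_k 'D_(delta_mx 0 k) g (x + t *: v)).
Proof.
move=> dg.
pose c (t : R) := g (x + t *: v).
have dc t : is_derive t (1 : R) c
    (dotv v (\row_k 'D_(delta_mx 0 k) g (x + t *: v))).
  (* The difference quotient of [c] at [t] is the one of [g] at [x + t *: v] in the direction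
     [v]. *)
  have E : (fun h : R => h^-1 *: ((c \o shift t) (h *: (1 : R)) - c t)) =
      (fun h : R =>
         h^-1 *: ((g \o shift (x + t *: v)) (h *: v) - g (x + t *: v))).
    apply/funext => h; rewrite /c/=; congr (_ *: (g _ - _)).
    have -> : h *: (1 : R) = h by rewrite /GRing.scale/= mulr1.
    by rewrite scalerDl addrCA.
  split; first by rewrite /derivable E; exact: diff_derivable.
  by rewrite /derive E -diff_dotv// -deriveE.
have [|t] := @MVT R c _ 0 1 ltr01 (fun t _ => dc t).
  apply: derivable_within_continuous => t _.
  by have [] := dc t.
rewrite in_itv/= subr0 mulr1 /c scale1r scale0r addr0 => t01 ->.
by exists t.
Qed.

End first_variation.

(** * Integrals against translated measures *)

Section translated_integrals.
Context (R : realType) (K : nat).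
Local Notation E := 'rV[R]_K.
Implicit Types (m : P2 R K) (x v : E).

Lemma translation_mass m v : image_measure m (translation v) setT = 1%E.
Proof. exact: probability_setT. Qed.

Lemma P2_finite m : (m setT < +oo)%E.
Proof. by rewrite probability_setT ltry. Qed.

Definition P2_translate m v : P2 R K :=
  P2_of_measure (translation_mass m v)
    (second_moment_translation v (P2_finite m) (P2_second_moment m)).

Lemma integrable_translate m v (f : E -> R) :
  (P2_translate m v).-integrable setT (EFin \o f) ->
  m.-integrable setT (EFin \o (f \o translation v)).
Proof.
move=> /integrableP[mf foo].
have mt : measurable_fun [set: E] (translation v) by exact: measurable_funP.
apply/integrableP; split; first exact: (measurableT_comp mf).
apply: le_lt_trans foo; rewrite [leRHS]ge0_integral_pushforward//.
exact: measurableT_comp.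
Qed.

Lemma Rintegral_translate m v (f : E -> R) :
  (P2_translate m v).-integrable setT (EFin \o f) ->
  \int[P2_translate m v]_x f x = \int[m]_x f (x + v).
Proof.
move=> intf.
have mt : measurable_fun [set: E] (translation v) by exact: measurable_funP.
congr fine; apply: etrans (integral_pushforward mt _ _ _) _ => //.
- by case/integrableP : intf.
- exact: integrable_translate.
Qed.

End translated_integrals.

(** * The first-order effect of a small translation *)

Section continuous_differentiability.
Context (R : realType) (K : nat).
Local Notation E := 'rV[R]_K.
Implicit Types (m : P2 R K) (x v w : E).

Lemma cvg_dotv (I : Type) (F : set_system I) {FF : Filter F} v (ww : I -> E) w :
  ww i @[i --> F] --> w -> dotv v (ww i) @[i --> F] --> dotv v w.
Proof.
move=> ww_w; apply: cvg_big => [|k _]; first exact: add_continuous.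
apply: cvgMl_tmp.
exact: (cvg_comp _ _ ww_w (@coord_continuous _ _ _ 0 k w)).
Qed.

Variables (u : P2 R K -> R) (u_C1 : C1 u).

(** Existence is part of [C1], so [xget] selects a genuine flat derivative and not its default
    value. *)
Lemma flat_derivativeP : is_flat_derivative u (flat_derivative u).
Proof. by case: u_C1 => ex _ _ _; exact: (xgetPex (fun _ _ => 0) ex). Qed.

Lemma cvg_Dm (I : Type) (F : set_system I) {FF : Filter F}
    (mm : I -> P2 R K) (xx : I -> E) m x :
  W2 m (mm i) @[i --> F] --> 0 -> xx i @[i --> F] --> x ->
  Dm u (mm i) (xx i) @[i --> F] --> Dm u m x.
Proof.
move=> mm_m xx_x; have [_ _ /(_ (m, x)) c _] := u_C1.
exact: (cvg_comp _ _ (cvg_pair (cvg_W2 mm_m) xx_x) c).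
Qed.

Lemma continuous_Dm m : continuous (Dm u m).
Proof.
move=> x; apply: (@cvg_Dm _ (nbhs x) _ (fun=> m) id) => //.
(* The constant family converges to [m] in the sense of [cvg_Dm] because [W2 m m] is 0. *)
by under eq_cvg do rewrite W2_refl; exact: cvg_cst.
Qed.

Lemma integrable_quadratic m (c d : R) :
  m.-integrable setT (fun x : E => (c + d * enorm x ^+ 2)%:E).
Proof.
have mq := @measurable_enorm_sq R K.
rewrite (_ : (fun x => _) =
  (EFin \o cst c) \+ (fun x : E => d%:E * (enorm x ^+ 2)%:E)%E)%E//.
apply: integrableD => //.
  exact: finite_measure_integrable_cst.
apply: integrableZl => //.
apply/integrableP; split=> //.
apply: le_lt_trans (P2_second_moment m).
rewrite le_eqVlt; apply/orP; left; apply/eqP.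
by apply: eq_integral => x _; rewrite gee0_abs// lee_fin sqr_ge0.
Qed.

Lemma integrable_Dm m k : m.-integrable setT (fun x : E => (Dm u m x 0 k)%:E).
Proof.
case: u_C1 => _ _ _ [C DmC].
apply: le_integrable (integrable_quadratic m C C) => //.
  apply/measurable_EFinP; apply: measurable_fun_rV_real => x.
  exact: (cvg_comp _ _ (@continuous_Dm m x) (@coord_continuous _ _ _ 0 k _)).
move=> x _; rewrite lee_fin (le_trans (normr_coord_le_enorm _ _))//.
rewrite (le_trans _ (ler_norm _))// (le_trans (DmC m x))//.
by rewrite mulrDr mulr1.
Qed.

Lemma Rintegral_dotv_Dm m v :
  \int[m]_x dotv v (Dm u m x) = dotv v (vintegral m (Dm u m)).
Proof.
rewrite /Rintegral /dotv; under eq_integral do rewrite -sumEFin.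
rewrite integral_sum//; last first.
  move=> k; under eq_fun do rewrite EFinM.
  by apply: integrableZl => //; exact: integrable_Dm.
rewrite (eq_bigr (fun k => (v 0 k * vintegral m (Dm u m) 0 k)%:E));
  first by rewrite sumEFin.
move=> k _.
under eq_integral do rewrite EFinM.
rewrite integralZl//; last exact: integrable_Dm.
rewrite mxE EFinM fineK//; apply: integrable_fin_num => //.
exact: integrable_Dm.
Qed.

(** The quotient is the integral of [g n], to which dominated convergence applies: the mean value
    theorem writes [g n x] as [v] paired with [Dm u (mm n)] at a point tending to [x]. The bound
    [1 <= s n] keeps the displacement below [v] in norm, uniformly in [n]. *)
Lemma cvg_translation_quotient m (mm : nat -> P2 R K) (s : nat -> R) v :
  (forall n, 1 <= s n) -> s n @[n --> \oo] --> +oo ->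
  W2 m (mm n) @[n --> \oo] --> 0 ->
  s n * (\int[P2_translate m ((s n)^-1 *: v)]_x flat_derivative u (mm n) x -
         \int[m]_x flat_derivative u (mm n) x) @[n --> \oo] -->
  dotv v (vintegral m (Dm u m)).
Proof.
move=> s1 soo mm_m; set f := flat_derivative u.
have s0 n : 0 < s n by exact: lt_le_trans (s1 n).
have [_ intf _] := flat_derivativeP; rewrite -/f in intf.
case: (u_C1) => _ df _ [C DmC].
pose g n x := s n * (f (mm n) (x + (s n)^-1 *: v) - f (mm n) x).
have gE n x : exists t, 0 < t < 1 /\
    g n x = dotv v (Dm u (mm n) (x + (t / s n) *: v)).
  have [t t01 E] := mean_value_line x ((s n)^-1 *: v) (df (mm n)).
  exists t; split => //; rewrite /g E scalerA /dotv mulr_sumr.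
  by apply: eq_bigr => k _; rewrite mxE !mulrA divff ?mul1r// gt_eqF.
have sV0 : (s n)^-1 @[n --> \oo] --> 0.
  by apply/gtr0_cvgV0 => //; exact: nearW.
have g_cvg x : g n x @[n --> \oo] --> dotv v (Dm u m x).
  (* Here [x] is fixed and the intermediate parameter varies with [n]; [t n / s n] is squeezed
     between 0 and [(s n)^-1]. *)
  have [t tE] := choice (gE ^~ x).
  rewrite (_ : (fun n => g n x) =
    (fun n => dotv v (Dm u (mm n) (x + (t n / s n) *: v)))); last first.
    by apply/funext => n; case: (tE n).
  apply: cvg_dotv; apply: cvg_Dm => //.
  rewrite -[X in _ --> X]addr0; apply: cvgD; first exact: cvg_cst.
  rewrite -(scale0r v); apply: cvgZr_tmp.
  apply: (squeeze_cvgr _ (cvg_cst 0) sV0); apply: nearW => n.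
  have [/andP[t0 t1] _] := tE n; rewrite divr_ge0 ?(ltW (s0 _)) ?(ltW t0)//=.
  by rewrite ler_pdivrMr// mulVf ?gt_eqF// ltW.
have C0 : 0 <= C.
  have := le_trans (sqrtr_ge0 _) (DmC m 0).
  by rewrite pmulr_lge0// ltr_pwDl// sqr_ge0.
pose V := \sum_k `|v 0 k|.
have V0 : 0 <= V by apply: sumr_ge0.
(* Quadratic growth of [Dm] at [x + (t / s n) *: v], expanded with [enorm_sqD]; the factor [V] comes
   from [normr_dotv_le]. *)
pose b x := V * (C * (1 + 2 * enorm v ^+ 2)) + V * (C * 2) * enorm x ^+ 2.
have g_b n x : `|g n x| <= b x.
  have [t [t01 ->]] := gE n x.
  rewrite (le_trans (normr_dotv_le _ _))// /b -[V * (C * 2) * _]mulrA -mulrDr.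
  rewrite ler_wpM2l// (le_trans (DmC _ _))// -mulrA -mulrDr ler_wpM2l//.
  have vle : enorm ((t / s n) *: v) ^+ 2 <= enorm v ^+ 2.
    rewrite enorm_sqZ ler_piMl ?sqr_ge0// expr_le1//.
      by rewrite ler_pdivrMr// mul1r (le_trans _ (s1 n))//; lra.
    by rewrite divr_ge0 ?(ltW (s0 _))//; lra.
  have := enorm_sqD x ((t / s n) *: v); lra.
have intft n : m.-integrable setT
    (EFin \o (f (mm n) \o translation ((s n)^-1 *: v))).
  by apply: integrable_translate; exact: intf.
(* Measurability is read off the definition of [g n] as a difference, since the intermediate point
   in [gE] need not depend measurably on [x]. *)
have mg n : measurable_fun [set: E] (EFin \o g n).
  apply/measurable_EFinP; apply: measurable_funM => //.
  apply: measurable_funB; apply/measurable_EFinP.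
    by case/integrableP : (intft n).
  by case/integrableP : (intf (mm n) m).
have mlim : measurable_fun [set: E] (fun x => (dotv v (Dm u m x))%:E).
  apply/measurable_EFinP; apply: measurable_fun_rV_real => x.
  exact: (cvg_dotv (@continuous_Dm m x)).
have ae_cvg : {ae m, forall x, setT x ->
    (EFin \o g n) x @[n --> \oo] --> (dotv v (Dm u m x))%:E}.
  by apply: aeW => x _; apply: cvg_EFin; [exact: nearW|exact: g_cvg].
have ae_b :
    {ae m, forall x n, setT x -> (`|(EFin \o g n) x| <= (EFin \o b) x)%E}.
  by apply: aeW => x n _; rewrite lee_fin.
have [intlim _ int_cvg] :=
  dominated_convergence measurableT mg mlim ae_cvg
    (integrable_quadratic _ _ _) ae_b.
have gE' n : \int[m]_x g n x = s n *
    (\int[P2_translate m ((s n)^-1 *: v)]_x f (mm n) x - \int[m]_x f (mm n) x).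
  rewrite RintegralZl//; last exact: (integrableB _ (intft n) (intf _ m)).
  by rewrite (RintegralB _ (intft n) (intf _ m))// Rintegral_translate.
under eq_cvg do rewrite -gE'.
rewrite -Rintegral_dotv_Dm; apply: fine_cvg.
by rewrite fineK//; exact: integrable_fin_num.
Qed.

End continuous_differentiability.

(** * The rescaled update as a mixture of small translates, and its limit *)

Section rescaled_update.
Context (R : realType) (K : nat).
Local Notation E := 'rV[R]_K.
Variables (a : distr R K) (P : pred {set 'I_K}) (v : {set 'I_K} -> E).
Variable m : P2 R K.
Hypothesis massP : 0 < mass a P.

(** Conditional weights, extended by 0 outside [P] so that mixtures range over the whole finite
    type. *)
Let w (j : {set 'I_K}) : R := if P j then a j / mass a P else 0.

Let w_ge0 j : 0 <= w j.
Proof.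
by rewrite /w; case: ifP => // _; rewrite divr_ge0 ?weight_ge0// ltW.
Qed.

Let sum_w : \sum_j w j = 1.
Proof. by rewrite /w -big_mkcond/= -mulr_suml divff// gt_eqF. Qed.

Definition rescaled_update (s : R) : P2 R K :=
  P2_dilate (update a P v (P2_dilate m s)) (1 / s).

(** Conjugating the translation by [v j] with the dilations of ratios [s] and [1 / s] gives the
    translation by [s^-1 *: v j]. *)
Lemma rescaled_updateE s B : s != 0 ->
  rescaled_update s B =
  (\sum_j (w j)%:E * m (translation (s^-1 *: v j) @^-1` B))%E.
Proof.
move=> s0; rewrite /rescaled_update/= /prob_of_measure/= /image_measure/=.
rewrite /pushforward/= /prob_of_measure/= /update_measure.
rewrite gt_eqF//= /sum_measure big_mkcond/=; apply: eq_bigr => j _.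
rewrite /w; case: ifPn => Pj; last by rewrite mul0e.
rewrite /image_measure/= /pushforward/= /mscale/= /prob_of_measure/=.
rewrite /image_measure/= /pushforward.
congr (_ * m _)%E; apply/seteqP; split => x /=;
  by rewrite /dilation /translation div1r scalerDr scalerA mulVf// scale1r.
Qed.

(** A point of the segment is again a mixture of translates of [m], indexed by pairs: the boolean
    selects the endpoint, and the copies coming from [m] are not moved. Bounding the weights by 1
    makes the estimate uniform in [h]. *)
Lemma W2_rescaled_update_le s h : 0 < s -> 0 <= h <= 1 ->
  W2 m (P2_mix h m (rescaled_update s)) <=
  s^-1 * Num.sqrt (\sum_j enorm (v j) ^+ 2).
Proof.
move=> s0 h01.
pose c (b : bool) : R := if b then h else 1 - h.
pose z (k : bool * {set 'I_K}) : E := if k.1 then s^-1 *: v k.2 else 0.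
have c0 b : 0 <= c b by rewrite /c; case: b; lra.
have c1 b : c b <= 1 by rewrite /c; case: b; lra.
apply: le_trans
  (@W2_translations_le _ _ _ (fun k => c k.1 * w k.2) z _ _ _ _ _) _.
- by move=> k; rewrite mulr_ge0.
- rewrite -(pair_bigA _ (fun b j => c b * w j))/=.
  under eq_bigr do rewrite -mulr_sumr sum_w mulr1.
  by rewrite big_bool /c/= addrC subrK.
- move=> B mB; apply: (etrans (P2_mixE _ _ _ h01)).
  rewrite rescaled_updateE ?gt_eqF//.
  rewrite -(pair_bigA _ (fun b j =>
    ((c b * w j)%:E * m (translation (z (b, j)) @^-1` B))%E))/=.
  rewrite big_bool/= addeC; congr (_ + _)%E.
    rewrite ge0_sume_distrr; last by move=> j _; rewrite mule_ge0 ?lee_fin.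
    by apply: eq_bigr => j _; rewrite EFinM muleA.
  rewrite (eq_bigr (fun j => ((1 - h) * w j)%:E * m B)%E); last first.
    move=> j _; congr (_ * m _)%E.
    by apply/seteqP; split => x; rewrite /= /translation/z/= addr0.
  rewrite -ge0_sume_distrl; last first.
    by move=> j _; rewrite lee_fin mulr_ge0//; lra.
  by rewrite sumEFin -mulr_sumr sum_w mulr1.
rewrite -[s^-1]gtr0_norm ?invr_gt0// -sqrtr_sqr -sqrtrM ?sqr_ge0// ler_wsqrtr//.
rewrite -(pair_bigA _ (fun b j => c b * w j * enorm (z (b, j)) ^+ 2))/=.
rewrite big_bool/= /z/=.
rewrite [X in _ + X]big1 ?addr0; last first.
  by move=> j _; rewrite enorm_sq /dotv big1 ?mulr0// => k _; rewrite mxE mul0r.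
rewrite mulr_sumr; apply: ler_sum => j _; rewrite enorm_sqZ.
have wj1 : w j <= 1 by rewrite -sum_w (bigD1 j)//= lerDl sumr_ge0.
by apply: ler_piMl; [rewrite mulr_ge0 ?sqr_ge0|rewrite mulr_ile1//; lra].
Qed.

Lemma rescaled_update_limit (u : P2 R K -> R) : C1 u ->
  s * (u (rescaled_update s) - u m) @[s --> +oo] -->
  \sum_(j | P j) a j / mass a P * dotv (v j) (vintegral m (Dm u m)).
Proof.
(* Dominated convergence concerns sequences, so the limit is tested along sequences tending to
   infinity. *)
move=> u_C1; apply/cvg_pinftyP => s' s'oo.
have uf := flat_derivativeP u_C1; have [_ intf _] := uf.
(* The dominating function requires the rescaling parameter to stay away
   from 0. *)
pose s n := Num.max 1 (s' n).
have s1 n : 1 <= s n by rewrite le_max lexx.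
have s0 n : 0 < s n by exact: lt_le_trans (s1 n).
have ss' : {near \oo, s' =1 s}.
  near=> n; rewrite /s max_r//; near: n.
  by move/cvgryPge : s'oo; apply.
have soo : s n @[n --> \oo] --> +oo.
  by apply: cvg_trans s'oo; apply: near_eq_cvg.
have [h hE] := choice (fun n => P2_mean_value uf m (rescaled_update (s n))).
pose mm n := P2_mix (h n) m (rescaled_update (s n)).
have h01 n : 0 < h n < 1 by case: (hE n).
have mm_m : W2 m (mm n) @[n --> \oo] --> 0.
  have sV0 : (s n)^-1 @[n --> \oo] --> 0.
    by apply/gtr0_cvgV0 => //; exact: nearW.
  have bnd : (s n)^-1 * Num.sqrt (\sum_j enorm (v j) ^+ 2) @[n --> \oo] --> 0.
    rewrite -[X in _ --> X](mul0r (Num.sqrt (\sum_j enorm (v j) ^+ 2))).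
    exact: cvgMr_tmp.
  apply: (squeeze_cvgr _ (cvg_cst 0) bnd); apply: nearW => n; rewrite W2_ge0/=.
  apply: W2_rescaled_update_le => //; have := h01 n; lra.
pose q j n := s n *
  (\int[P2_translate m ((s n)^-1 *: v j)]_x flat_derivative u (mm n) x -
   \int[m]_x flat_derivative u (mm n) x).
have quotE n : s n * (u (rescaled_update (s n)) - u m) =
    \sum_j w j * q j n.
  have [_ ->] := hE n.
  rewrite (Rintegral_finite_mixture w_ge0
    (nu := fun j => P2_translate m ((s n)^-1 *: v j))).
  (* As the weights sum to 1, the integral against [m] is distributed over the outcomes. *)
  - rewrite -[X in _ - X]mul1r -sum_w mulr_suml -sumrB mulr_sumr.
    by apply: eq_bigr => j _; rewrite -mulrBr mulrCA.
  - by move=> B _; rewrite -rescaled_updateE// gt_eqF.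
  - exact: intf.
  - by move=> j; exact: intf.
rewrite big_mkcond/=.
rewrite (eq_bigr (fun j => w j * dotv (v j) (vintegral m (Dm u m)))); last first.
  by move=> j _; rewrite /w; case: ifP => // _; rewrite mul0r.
have lim : \sum_j w j * q j n @[n --> \oo] -->
    \sum_j w j * dotv (v j) (vintegral m (Dm u m)).
  apply: cvg_big => [|j _]; first exact: add_continuous.
  by apply: cvgMl_tmp; exact: cvg_translation_quotient.
apply: cvg_trans lim; apply: near_eq_cvg; near=> n.
by rewrite -quotE (near ss').
Unshelve. all: by end_near.
Qed.

End rescaled_update.

(** * The two updates, with [s] the square root of [T] *)

Lemma dotv_linear_sum (R : realType) (K : nat) (I : finType) (P : pred I)
    (c : I -> R) (v : I -> 'rV[R]_K) (w : 'rV[R]_K) :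
  dotv (\sum_(i | P i) c i *: v i) w = \sum_(i | P i) c i * dotv (v i) w.
Proof.
rewrite /dotv; under [RHS]eq_bigr do rewrite mulr_sumr.
rewrite exchange_big/=; apply: eq_bigr => k _.
by rewrite summxE mulr_suml; apply: eq_bigr => i _; rewrite mxE mulrA.
Qed.

Lemma dotvN (R : realType) (K : nat) (v w : 'rV[R]_K) :
  dotv (- v) w = - dotv v w.
Proof. by rewrite /dotv -sumrN; apply: eq_bigr => k _; rewrite mxE mulNr. Qed.

Lemma cvgr_sqrtr_pinfty (R : realType) :
  Num.sqrt T @[T --> (+oo : set_system R)] --> +oo.
Proof.
apply/cvgryPge => M.
move: (nbhs_pinfty_ge (num_real (M ^+ 2))); apply: filterS => T MT.
by rewrite (le_trans (ler_norm M))// -sqrtr_sqr ler_wsqrtr.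
Qed.

Theorem proposition3p1 (R : realType) (K : nat) (hK : (2 <= K)%N)
    (u : P2 R K -> R) (hu : C1 u) (m : P2 R K) (a : distr R K) (i : 'I_K) :
  (0 < hat_pos a i ->
     Num.sqrt T * (u (A_pos a m i (Num.sqrt T)) - u m) @[T --> +oo] -->
       - dotv (V_pos a i) (vintegral m (Dm u m)))
  /\
  (0 < hat_neg a i ->
     Num.sqrt T * (u (A_neg a m i (Num.sqrt T)) - u m) @[T --> +oo] -->
       dotv (V_neg a i) (vintegral m (Dm u m))).
Proof.
split=> mass_gt0; rewrite dotv_linear_sum.
  (* The minus sign of the limit is absorbed into the translations, which are opposite to the
     vectors averaged in [V_pos]. *)
  rewrite -sumrN; under eq_bigr do rewrite -mulrN -dotvN.
  exact: (cvg_comp _ _ (@cvgr_sqrtr_pinfty R) (rescaled_update_limit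
    (v := fun j => - basis_sum R (~: j)) mass_gt0 hu)).
exact: (cvg_comp _ _ (@cvgr_sqrtr_pinfty R) (rescaled_update_limit
  (v := fun j => basis_sum R j) mass_gt0 hu)).
Qed.
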